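(* For any fixed $n\ge 1$, the sequences $$\ell_{2n,1}^{\mathrm{d2row}},\ \ell_{2n,2}^{\mathrm{d2row}},\dots,\ell_{2n,n}^{\mathrm{d2row}}\quad\text{and}\quad i_{2n,1}^{\mathrm{d2row}},\ i_{2n,2}^{\mathrm{d2row}},\dots,i_{2n,n}^{\mathrm{d2row}}$$ are log concave.
   Context: $\mathfrak S_{2n}$ is the set of permutations of $\{1,\dots,2n\}$. For $\pi\in\mathfrak S_{2n}$, $\ell(\pi)$ is the length of a longest increasing subsequence of $\pi$ (in one-line notation). The shape $\operatorname{sh}\pi$ is the common shape (a partition of $2n$) of the two standard Young tableaux associated with $\pi$ by the Robinson–Schensted correspondence. Let $\mathrm{d2row}$ be the set of partitions of $2n$ of the form $(k^2,(n-k)^2)=(k,k,n-k,n-k)$ with $n/2\le k\le n$ (for $k=n$ this is $(n,n)$). Then $\ell_{2n,k}^{\mathrm{d2row}}$ is the number of $\pi\in\mathfrak S_{2n}$ with $\ell(\pi)=k$ and $\operatorname{sh}\pi\in\mathrm{d2row}$, and $i_{2n,k}^{\mathrm{d2row}}$ is the number of involutions $\pi\in\mathfrak S_{2n}$ (permutations whose square is the identity) with $\ell(\pi)=k$ and $\operatorname{sh}\pi\in\mathrm{d2row}$. (These numbers are $0$ for $k<n/2$.) A sequence of real numbers $l_1,\dots,l_n$ is log concave if $l_{k-1}l_{k+1}\le l_k^2$ for all $1\le k\le n$, with the convention $l_0=l_{n+1}=0$. *)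

(* Defs.v *)
From mathcomp Require Import all_boot all_order all_fingroup all_algebra.

Set Implicit Arguments.
Unset Strict Implicit.
Unset Printing Implicit Defensive.

(* A permutation of {1, ..., m} is represented by 'S_m = {perm 'I_m}, so
   positions and values start at 0. *)
Definition one_line (m : nat) (p : 'S_m) : seq nat :=
  [seq val (p i) | i <- enum 'I_m].

(* An increasing subsequence is given by the set of its positions. *)
Definition increasing_on (m : nat) (p : 'S_m) (A : {set 'I_m}) : bool :=
  [forall i in A, forall j in A, (i < j) ==> (p i < p j)].

Definition longest_incr (m : nat) (p : 'S_m) : nat :=
  \max_(A : {set 'I_m} | increasing_on p A) #|A|.

(* [row_insert x r] puts x in place of the leftmost entry y > x of r and
   returns y as the bumped entry; if there is no such y, x is appended and
   nothing is bumped. *)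
Fixpoint row_insert (x : nat) (r : seq nat) : option nat * seq nat :=
  match r with
  | [::] => (None, [:: x])
  | y :: r' =>
      if x < y then (Some y, x :: r')
      else let: (b, r'') := row_insert x r' in (b, y :: r'')
  end.

(* A tableau is the list of its rows, the first row being the longest. *)
Fixpoint tableau_insert (x : nat) (T : seq (seq nat)) : seq (seq nat) :=
  match T with
  | [::] => [:: [:: x]]
  | r :: T' =>
      match row_insert x r with
      | (None, r') => r' :: T'
      | (Some y, r') => r' :: tableau_insert y T'
      end
  end.

Definition insertion_tableau (w : seq nat) : seq (seq nat) :=
  foldl (fun T x => tableau_insert x T) [::] w.

(* The shape is read off the insertion tableau; the recording tableau has the
   same shape by construction. Partitions are lists of nonzero parts. *)
Definition sh (m : nat) (p : 'S_m) : seq nat :=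
  shape (insertion_tableau (one_line p)).

(* The partition (k, k, n - k, n - k), without its zero parts when k = n. *)
Definition double_two_row (n k : nat) : seq nat :=
  [seq x <- [:: k; k; n - k; n - k] | 0 < x].

Definition d2row (n : nat) : pred (seq nat) :=
  [pred la | [exists k : 'I_n.+1,
     (n <= 2 * k) && (la == double_two_row n k)]].

Definition ell_d2row (n k : nat) : nat :=
  #|[set p : 'S_(2 * n) | (longest_incr p == k) && (sh p \in d2row n)]|.

Definition involution (m : nat) (p : 'S_m) : bool := (p * p == 1)%g.

Definition inv_d2row (n k : nat) : nat :=
  #|[set p : 'S_(2 * n) |
      [&& involution p, longest_incr p == k & sh p \in d2row n]]|.

(* Only the terms l 1, ..., l n matter: all the others are replaced by 0. *)
Definition log_concave (R : realDomainType) (n : nat) (l : nat -> R) : Prop :=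
  let l0 k := if 0 < k <= n then l k else 0%R in
  forall k, 0 < k <= n -> (l0 k.-1 * l0 k.+1 <= l0 k ^+ 2)%R.

(* Main.v *)
Require Import Defs.
From mathcomp Require Import all_boot all_order all_fingroup all_algebra.
From mathcomp Require Import zify ring.
Import GRing.Theory Num.Theory.

(** Both sequences are read off the numbers f_k of standard Young tableaux of
    shape (k, k, n-k, n-k): by the Robinson-Schensted correspondence and
    Schensted's theorem the terms are f_k ^ 2, and since inverting a permutation
    exchanges its two tableaux, the involutions are counted by f_k itself.  The
    correspondence is obtained from Fomin's growth diagrams, with tableaux
    encoded as Yamanouchi words: labelling each grid edge by the row of the box
    it adds, the local rule on a cell involves only the two incoming labels and
    is visibly symmetric and reversible.  Finally f_k = (2n)! D_k / A_k with
    D_k = (e+1)(e+2)^2(e+3) for e = 2k-n and A_k = (k+3)!(k+2)!(n-k+1)!(n-k)!;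
    D is log concave in k and A is log convex. *)

(** * Row insertion on Yamanouchi words by the local rule *)

(* Edge labels are shifted by one: r.+1 stands for a box added in row r (rows
   counted from 0) and 0 for no box.  [c] tells whether the cell contains a point
   of the permutation; the cell raises both labels or neither. *)
Definition grows (c : bool) (a b : nat) : bool := (a == b) && ((0 < a) || c).

(* A word W records a tableau on values below [size W]: the label of value j is
   entry j counted from the end, so the head is the label of the largest value.
   [strip x W] is the row insertion of x: the new word, and the label of the new
   box. *)
Fixpoint strip (x : nat) (W : seq nat) : nat * seq nat :=
  if W is b :: W0 then
    let: (a, W1) := strip x W0 in
    let e := grows (x == size W0) a b in (a + e, b + e :: W1)
  else (0, [::]).

Fixpoint absent (x : nat) (W : seq nat) : bool :=
  if W is b :: W0 then ((x == size W0) ==> (b == 0)) && absent x W0 else true.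

Definition cnt (r : nat) (W : seq nat) : nat := count_mem r W.
Arguments cnt : simpl never.

Lemma cnt_cons r b W : cnt r (b :: W) = (b == r) + cnt r W.
Proof. by []. Qed.

(** Lattice condition on suffixes, since words grow at the head: a box may enter a row below the
    first only if that row is strictly shorter than the one above. Labels 0 and 1 are free. *)
Fixpoint yam (W : seq nat) : bool :=
  if W is b :: W0 then
    (if b is r.+2 then cnt r.+2 W0 < cnt r.+1 W0 else true) && yam W0
  else true.

Lemma yam_count W r : yam W -> cnt r.+2 W <= cnt r.+1 W.
Proof.
elim: W => //= b W IH /andP[hb /IH]; rewrite !cnt_cons; case: b hb => [|[|s]] //=; try lia.
by case: (s =P r) => [->|]; lia.
Qed.

Lemma strip_cons x b W : strip x (b :: W) =
  ((strip x W).1 + grows (x == size W) (strip x W).1 b,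
   b + grows (x == size W) (strip x W).1 b :: (strip x W).2).
Proof. by rewrite /=; case: (strip x W). Qed.

Lemma size_strip x W : size (strip x W).2 = size W.
Proof. by elim: W => // b W IH; rewrite strip_cons /= IH. Qed.

Lemma count_strip x W r :
  cnt r.+1 (strip x W).2 = cnt r.+1 W + ((strip x W).1 == r.+1).
Proof.
elim: W => // b W IH; rewrite strip_cons /= !cnt_cons {}IH /grows.
by case: (_ =P b) => [->|_] /=; [case: b => [|b]; case: (x == size W) => /= |]; lia.
Qed.

(** Raising label r+1 to r+2 is legal because the smaller values have just gained one letter r+1 and
    no r+2. If the two labels differ, the new box is not in the row of [b], so the old strict
    inequality survives. *)
Lemma yam_strip x W : yam W -> yam (strip x W).2.
Proof.
elim: W => // b W IH /= /andP[hb yW]; have := IH yW.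
have C := count_strip x W; have Y := fun r => yam_count W r yW.
case: (strip x W) C => a W1 /= C ->; rewrite andbT.
rewrite /grows; case: eqP => [eab|neab] /=.
  subst b; case: a C hb => [|r] C hb.
    by case: (x == size W).
  by rewrite addn1 !C eqxx (ltn_eqF (ltnSn _)) addn0 addn1 ltnS Y.
rewrite addn0; case: b hb neab => [|[|r]] // hb neab.
by rewrite !C; case: eqP => //; lia.
Qed.

Lemma strip_ge x W : size W <= x -> strip x W = (0, W).
Proof.
elim: W => // b W IH /= lt; rewrite IH ?(ltnW lt) // /grows.
by rewrite (gtn_eqF lt) /= andbF !addn0.
Qed.

Lemma absent_ge x W : size W <= x -> absent x W.
Proof. by elim: W => // b W IH /= lt; rewrite gtn_eqF //= IH // ltnW. Qed.

Lemma strip_gt0 x W : x < size W -> absent x W -> 0 < (strip x W).1.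
Proof.
elim: W => // b W IH; rewrite strip_cons /= => lt /andP[hb aW].
case: (ltnP x (size W)) => [lt'|ge]; first by rewrite addn_gt0 IH.
have e : x = size W by lia.
by move: hb; rewrite strip_ge // e eqxx /= => /eqP->.
Qed.

Lemma absent_strip x y W : x < size W -> absent x W ->
  absent y (strip x W).2 = absent y W && (y != x).
Proof.
elim: W => // b W IH; rewrite strip_cons /= size_strip => lt /andP[hb aW].
case: (ltnP x (size W)) => [lt'|ge].
  rewrite (IH lt' aW) (ltn_eqF lt').
  have p := strip_gt0 _ _ lt' aW.
  case: (y =P size W) => [->|] //=.
  by rewrite /grows; case: b {hb lt} => [|b]; rewrite ?(gtn_eqF p).
have e : x = size W by lia.
move: hb; rewrite strip_ge // e eqxx /= => /eqP-> /=.
by case: (y =P size W) => [->|] /=; rewrite ?andbF ?andbT.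
Qed.

(** The local rule is reversible: outgoing labels are equal and positive exactly when the cell
    raised them. The inserted value is then located by the carried label, which is 0 up to the
    marked cell and positive after it. *)
Lemma strip_inj x1 x2 W1 W2 : x1 < size W1 -> x2 < size W2 ->
  absent x1 W1 -> absent x2 W2 -> strip x1 W1 = strip x2 W2 -> x1 = x2 /\ W1 = W2.
Proof.
elim: W1 W2 => [|b1 W1 IH] [|b2 W2] //.
rewrite !strip_cons => /= lt1 lt2 /andP[hb1 aW1] /andP[hb2 aW2] [ea eb eW].
have es : size W1 = size W2 by rewrite -(size_strip x1) eW size_strip.
have [eg|neg] := eqVneq (grows (x1 == size W1) (strip x1 W1).1 b1)
                        (grows (x2 == size W2) (strip x2 W2).1 b2); last first.
  move: neg ea eb; rewrite /grows; set a1 := (strip x1 W1).1; set a2 := (strip x2 W2).1.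
  case: (a1 =P b1); case: (a2 =P b2); case: (x1 == _); case: (x2 == _);
    by rewrite ?orbT ?orbF; lia.
have {}ea : (strip x1 W1).1 = (strip x2 W2).1 by lia.
have {}eb : b1 = b2 by lia.
have eS : strip x1 W1 = strip x2 W2.
  by rewrite (surjective_pairing (strip x1 W1)) ea eW -surjective_pairing.
move: lt1 lt2; rewrite ltnS leq_eqVlt [x2 < _]ltnS [x2 <= _]leq_eqVlt.
case: (x1 =P size W1) eg hb1 => [e1|n1] eg hb1 /=.
  case: (x2 =P size W2) eg hb2 => [e2|n2] eg hb2 /= _ lt2.
    by move: eS; rewrite !strip_ge ?e1 ?e2 // -es => -[->]; rewrite eb.
  by have := strip_gt0 _ _ lt2 aW2; rewrite -eS strip_ge ?e1.
move=> lt1; case: (x2 =P size W2) eg hb2 => [e2|n2] eg hb2 /= lt2.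
  by have := strip_gt0 _ _ lt1 aW1; rewrite eS strip_ge ?e2.
by have [//|//|//|//||-> ->] := IH W2; rewrite ?eb.
Qed.

(* Reverse insertion, removing the corner in row a. *)
Lemma strip_surj a W : yam W -> cnt a.+2 W < cnt a.+1 W ->
  exists x W', [/\ x < size W, size W' = size W, yam W', absent x W'
                 & strip x W' = (a.+1, W)].
Proof.
elim: W a => // b W IH a /= /andP[hb yW] hc.
have [eba|nba] := eqVneq b a.+1; last first.
  have [|x [W' [lx sW' yW' aW' eW']]] := IH a yW.
    by move: hc; rewrite !cnt_cons (negPf nba); lia.
  exists x, (b :: W'); rewrite strip_cons eW' /= sW' (ltn_eqF lx) aW' yW' (leqW lx).
  rewrite /grows (eq_sym _ b) (negPf nba) !addn0; split=> //.
  rewrite andbT; have C := count_strip x W'; rewrite eW' /= in C.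
  case: b hb hc nba => [|[|r]] //; rewrite !cnt_cons !C.
  by case: (a =P r) => [->|]; rewrite ?eqxx; case: eqP => //=; lia.
subst b; case: a hb hc => [|a] hb hc.
  exists (size W), (0 :: W); rewrite /= eqxx yW strip_ge // absent_ge //.
have [//|x [W' [lx sW' yW' aW' eW']]] := IH a yW.
exists x, (a.+1 :: W'); rewrite strip_cons eW' /= sW' (ltn_eqF lx) aW' yW' (leqW lx).
rewrite /grows eqxx /= !addn1; split=> //; rewrite andbT.
have C := count_strip x W'; rewrite eW' /= in C.
case: a hb hc C {eW' aW' lx IH} => // a hb hc C.
have := yam_count W a yW; rewrite !C eqxx; case: eqP; lia.
Qed.

(** * Bijection between words and pairs of Yamanouchi words *)

(* Words w are also read from the end: the head of w is inserted last. *)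
Fixpoint rs (m : nat) (w : seq nat) : seq nat * seq nat :=
  if w is x :: w0 then
    let: (W, Q) := rs m w0 in let: (a, W1) := strip x W in (W1, a :: Q)
  else (nseq m 0, [::]).

Lemma rs_cons m x w : rs m (x :: w) =
  ((strip x (rs m w).1).2, (strip x (rs m w).1).1 :: (rs m w).2).
Proof. by rewrite /=; case: (rs m w) => W Q /=; case: (strip x W). Qed.

Definition word_of (m : nat) (w : seq nat) : bool := uniq w && all (gtn m) w.

Lemma size_rs1 m w : size (rs m w).1 = m.
Proof. by elim: w => [|x w IH]; rewrite ?rs_cons /= ?size_nseq ?size_strip. Qed.

Lemma size_rs2 m w : size (rs m w).2 = size w.
Proof. by elim: w => // x w IH; rewrite rs_cons /= IH. Qed.

Lemma absent_nseq x m : absent x (nseq m 0).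
Proof. by elim: m => //= m ->; rewrite implybT. Qed.

Lemma word_of_cons m x w : word_of m (x :: w) = [&& x < m, x \notin w & word_of m w].
Proof. by rewrite /word_of /=; case: (x < m); case: (x \in w); rewrite ?andbF. Qed.

Lemma absent_rs m w x : word_of m w -> x < m -> absent x (rs m w).1 = (x \notin w).
Proof.
elim: w x => [|y w IH] x; first by rewrite absent_nseq.
rewrite word_of_cons rs_cons => /and3P[ltm yw ww] lx /=.
by rewrite absent_strip ?size_rs1 ?IH // inE negb_or andbC.
Qed.

Lemma yam_nseq m : yam (nseq m 0).
Proof. by elim: m. Qed.

Lemma yam_rs1 m w : yam (rs m w).1.
Proof. by elim: w => [|x w IH]; rewrite ?rs_cons /= ?yam_nseq ?yam_strip. Qed.

Lemma count_rs m w r : cnt r.+1 (rs m w).1 = cnt r.+1 (rs m w).2.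
Proof.
elim: w => [|x w IH]; first by rewrite /cnt /= count_nseq.
by rewrite rs_cons /= count_strip IH cnt_cons addnC.
Qed.

Lemma rs_inj m w1 w2 : word_of m w1 -> word_of m w2 -> rs m w1 = rs m w2 -> w1 = w2.
Proof.
elim: w1 w2 => [|x w1 IH] w2.
  by case: w2 => // y w2; rewrite rs_cons.
case: w2 => [|y w2]; rewrite ?rs_cons // !word_of_cons.
move=> /and3P[lx xw ww1] /and3P[ly yw ww2] [e1 e2 e3].
have [|||||-> eW] := strip_inj x y (rs m w1).1 (rs m w2).1;
  rewrite ?size_rs1 ?absent_rs //.
  by rewrite (surjective_pairing (strip x _)) e1 e2 -surjective_pairing.
congr cons; apply: IH => //.
by rewrite (surjective_pairing (rs m w1)) eW e3 -surjective_pairing.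
Qed.

(** Insertions are undone one by one: the head of [Q] names the row of [W] to shorten, which ends in
    a corner because [Q] is Yamanouchi with the same counts. Only [Q] must avoid 0: values missing
    from the word leave zeros in [W]. *)
Lemma rs_surj m W Q : yam W -> yam Q -> 0 \notin Q -> size W = m ->
    (forall r, cnt r.+1 W = cnt r.+1 Q) ->
  exists w, word_of m w /\ rs m w = (W, Q).
Proof.
elim: Q W => [|[|a] Q IH] W //= yW yQ Q0 sW hc.
  exists [::]; split=> //=; congr pair; rewrite -sW.
  elim: W hc {yW sW} => //= b W IHW hc.
  by case: b hc => [|b] hc; [rewrite IHW | have := hc b; rewrite cnt_cons eqxx].
have /andP[{}hQ yQ'] := yQ.
have [|x [W' [lx sW' yW' aW' eW']]] := strip_surj a W yW.
  have := yam_count Q a yQ'; rewrite !hc !cnt_cons; lia.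
have C := count_strip x W'; rewrite eW' /= in C.
have [||||r|w [ww ew]] := IH W'; rewrite ?sW' //.
  by have := C r; rewrite hc cnt_cons; lia.
have lxm : x < m by rewrite -sW.
exists (x :: w); rewrite word_of_cons rs_cons ew /= eW' ww lxm /= andbT.
by split=> //; rewrite -(absent_rs m) // ew.
Qed.

(** * Agreement with row insertion on tableaux *)

Fixpoint append_row (z b : nat) (T : seq (seq nat)) : seq (seq nat) :=
  match T, b with
  | [::], _ => [:: [:: z]]
  | r :: T', 0 => rcons r z :: T'
  | r :: T', b'.+1 => r :: append_row z b' T'
  end.

Fixpoint new_row (x : nat) (T : seq (seq nat)) : nat :=
  if T is r :: T' then
    if (row_insert x r).1 is Some y then (new_row y T').+1 else 0
  else 0.

(** Values are placed in increasing order, so each goes to the end of its row. *)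
Fixpoint tableau_of (W : seq nat) : seq (seq nat) :=
  match W with
  | [::] => [::]
  | 0 :: W0 => tableau_of W0
  | r.+1 :: W0 => append_row (size W0) r (tableau_of W0)
  end.

Lemma row_insert_max z r : all (gtn z) r -> row_insert z r = (None, rcons r z).
Proof. by elim: r => //= y r IH /andP[lt /IH->]; rewrite ltnNge (ltnW lt). Qed.

Lemma row_insert_rcons x z r : x < z -> row_insert x (rcons r z) =
  if (row_insert x r).1 is Some y then (Some y, rcons (row_insert x r).2 z)
  else (Some z, (row_insert x r).2).
Proof.
move=> lt; elim: r => /= [|y r IH]; first by rewrite lt.
by case: (x < y) => //; rewrite IH; case: (row_insert x r) => [[]].
Qed.

Lemma row_insert_bump x y r : (row_insert x r).1 = Some y -> y \in r.
Proof.
elim: r => //= y' r IH; case: (x < y') => [[->]|]; first exact: mem_head.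
by rewrite inE; case: (row_insert x r) IH => b r' /= IH /IH->; rewrite orbT.
Qed.

Lemma tableau_insert_cons x r T : tableau_insert x (r :: T) =
  if (row_insert x r).1 is Some y then (row_insert x r).2 :: tableau_insert y T
  else (row_insert x r).2 :: T.
Proof. by rewrite /=; case: (row_insert x r) => [[]]. Qed.

Lemma tableau_insert_max z T : all (all (gtn z)) T ->
  tableau_insert z T = append_row z 0 T /\ new_row z T = 0.
Proof. by case: T => //= r T /andP[ar _]; rewrite row_insert_max. Qed.

Arguments tableau_insert : simpl never.

(* Appending a new largest entry z in row b commutes with insertion, except that
   z moves down one row when the insertion ends in row b: this is the local rule
   of growth diagrams. *)
Lemma tableau_insert_append x z b T :
    x < z -> all (all (gtn z)) T -> b <= size T ->
  tableau_insert x (append_row z b T) =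
    append_row z (b + (new_row x T == b)) (tableau_insert x T) /\
  new_row x (append_row z b T) = new_row x T + (new_row x T == b).
Proof.
elim: T x b => [|r T IH] x b lt /=.
  by case: b => //= _ _; rewrite /tableau_insert /= lt.
case/andP=> ar aT; case: b => [|b] lb.
  rewrite !tableau_insert_cons /= row_insert_rcons //.
  case: (row_insert x r).1 => [y|] /=; first by rewrite addn0.
  by have [-> ->] := tableau_insert_max z T aT.
rewrite !tableau_insert_cons /=.
case: (row_insert x r).1 (row_insert_bump x ^~ r) => [y|] hy; last by rewrite addn0.
have [|//|//|-> ->] := IH y b; first by apply: (allP ar); apply: hy.
by rewrite eqSS addSn.
Qed.

Lemma shape_append z b T : b <= size T ->
  shape (append_row z b T) = incr_nth (shape T) b.
Proof.
elim: T b => [|r T IH] [|b] //= lb; first by rewrite size_rcons.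
by congr cons; apply: IH.
Qed.

Lemma shape_tableau_of W : yam W ->
  (forall r, nth 0 (shape (tableau_of W)) r = cnt r.+1 W) /\
  0 \notin shape (tableau_of W).
Proof.
elim: W => [|b W IH] /=; first by split=> // r; rewrite nth_nil.
case/andP=> hb /IH[hn h0]; case: b hb => [|b] // hb.
have lb : b <= size (tableau_of W).
  (* By the Yamanouchi condition the row above is nonempty, hence exists: [nth] would give 0 past
     the last row. *)
  case: b hb => // b; rewrite -!hn => hb; rewrite ltnNge; apply/negP => le.
  by move: hb; rewrite [X in _ < X]nth_default // size_map.
rewrite shape_append //; split=> [r|].
  by rewrite nth_incr_nth hn cnt_cons eqSS.
apply/negP => /(nthP 0)[i]; rewrite size_incr_nth nth_incr_nth => lt.
case: eqP => // nbi e; case/negP: h0; rewrite -e; apply: mem_nth.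
case: ifP lt => // _; rewrite ltnS leq_eqVlt eq_sym => /orP[/eqP //|lt].
by rewrite (leq_trans lt) // size_map.
Qed.

Lemma all_append z b T x : all (all (gtn x)) T -> z < x ->
  all (all (gtn x)) (append_row z b T).
Proof.
elim: T b => [|r T IH] [|b] //=; rewrite ?andbT // => /andP[ar aT] lt.
  by rewrite all_rcons /= lt ar.
by rewrite ar IH.
Qed.

Lemma all_tableau_of W : all (all (gtn (size W))) (tableau_of W).
Proof.
elim: W => //= b W IH.
have {}IH : all (all (gtn (size W).+1)) (tableau_of W).
  by apply: sub_all IH => r; apply: sub_all => i /= /leqW.
by case: b => [|b] //; apply: all_append.
Qed.

Lemma label_le b W : yam (b.+1 :: W) -> b <= size (tableau_of W).
Proof.
move=> /= /andP[+ yW]; case: b => // b.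
have [hn _] := shape_tableau_of W yW; rewrite -!hn => hb.
rewrite ltnNge; apply/negP => le.
by move: hb; rewrite [X in _ < X]nth_default // size_map.
Qed.

(** Induction on the largest value: [tableau_insert_append] moves it exactly as [grows] changes its
    label. If [x] is itself the largest value, it is appended to the first row. *)
Lemma tableau_of_strip x W : yam W -> x < size W -> absent x W ->
  tableau_of (strip x W).2 = tableau_insert x (tableau_of W) /\
  (strip x W).1 = (new_row x (tableau_of W)).+1.
Proof.
elim: W => // b W IH yW; rewrite strip_cons => /= lt /andP[hb aW].
have /andP[_ yW0] := yW.
case: (ltnP x (size W)) => [lt'|ge]; last first.
  have e : x = size W by lia.
  move: hb; rewrite strip_ge // e eqxx /= => /eqP-> /=.
  by have [-> ->] := tableau_insert_max _ _ (all_tableau_of W).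
have [eT eN] := IH yW0 lt' aW; rewrite (ltn_eqF lt') eN /grows orbF andbT.
case: b yW {hb} => [|b] yW /=; first by rewrite eT !addn0.
have [||//|-> ->] := tableau_insert_append x (size W) b (tableau_of W) => //.
- exact: all_tableau_of.
- exact: label_le.
by rewrite eqSS size_strip eT.
Qed.

Lemma tableau_of_nseq m : tableau_of (nseq m 0) = [::].
Proof. by elim: m. Qed.

Lemma insertion_tableau_rs m w : word_of m w ->
  insertion_tableau (rev w) = tableau_of (rs m w).1.
Proof.
rewrite /insertion_tableau foldl_rev; elim: w => [|x w IH].
  by rewrite tableau_of_nseq.
rewrite word_of_cons rs_cons => /and3P[lx xw ww] /=; rewrite IH //.
by have [|||-> _] := tableau_of_strip x (rs m w).1;
  rewrite ?yam_rs1 ?size_rs1 ?absent_rs.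
Qed.

Lemma eq_from_nth_pos s1 s2 : 0 \notin s1 -> 0 \notin s2 ->
  nth 0 s1 =1 nth 0 s2 -> s1 = s2.
Proof.
have le s s' : 0 \notin s -> nth 0 s =1 nth 0 s' -> size s <= size s'.
  move=> h e; rewrite leqNgt; apply/negP => lt; case/negP: h.
  by rewrite -(nth_default 0 (leqnn (size s'))) -e mem_nth.
move=> h1 h2 e; apply: (@eq_from_nth _ 0) => [|i _]; last exact: e.
by apply/eqP; rewrite eqn_leq !le // => i; rewrite e.
Qed.

(** * Growth diagrams and their transposition *)

(* [vlab c i j] and [glab c i j] label the edges leaving the grid point (i, j)
   in the value and in the position direction; c is the set of cells marked by
   the permutation. *)
Fixpoint hlab (c : pred nat) (v : nat -> nat) (j : nat) : nat :=
  if j is j'.+1 then hlab c v j' + grows (c j') (hlab c v j') (v j') else 0.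

Fixpoint vlab (c : rel nat) (i : nat) : nat -> nat :=
  if i is i'.+1 then
    fun j => vlab c i' j + grows (c i' j) (hlab (c i') (vlab c i') j) (vlab c i' j)
  else fun=> 0.

Definition glab (c : rel nat) (i j : nat) : nat := hlab (c i) (vlab c i) j.

Fixpoint down (f : nat -> nat) (m : nat) : seq nat :=
  if m is j.+1 then f j :: down f j else [::].

Lemma glabS c i j : glab c i j.+1 = glab c i j + grows (c i j) (glab c i j) (vlab c i j).
Proof. by []. Qed.

Lemma vlabS c i j : vlab c i.+1 j = vlab c i j + grows (c i j) (glab c i j) (vlab c i j).
Proof. by []. Qed.

Lemma growsC c a b : grows c a b = grows c b a.
Proof. by rewrite /grows eq_sym; case: eqP => // ->. Qed.

(** Both the local rule and the zero boundary are symmetric in the two directions. For permutations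
    this makes inversion exchange the two words. *)
Lemma grid_transpose (c c' : rel nat) : (forall i j, c' j i = c i j) ->
  forall i j, vlab c' j i = glab c i j /\ glab c' j i = vlab c i j.
Proof.
move=> cc; elim=> [|i IHi].
  elim=> [|j [IHj IHj']] //; split=> //.
  by rewrite vlabS glabS IHj IHj' cc growsC.
have E j : glab c' j i.+1 = vlab c i.+1 j.
  by have [e1 e2] := IHi j; rewrite vlabS glabS e1 e2 cc growsC.
by elim=> [|j [IHj _]]; split=> //; rewrite vlabS E IHj glabS cc growsC.
Qed.

Lemma size_down f m : size (down f m) = m.
Proof. by elim: m => //= m ->. Qed.

Lemma rev_mkseq f m : rev (mkseq f m) = down f m.
Proof. by elim: m => // m IH; rewrite mkseqS rev_rcons IH. Qed.

Lemma strip_down (c : pred nat) x v j : (forall j, c j = (x == j)) ->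
  strip x (down v j) = (hlab c v j, down (fun j => v j + grows (c j) (hlab c v j) (v j)) j).
Proof. by move=> hc; elim: j => //= j ->; rewrite size_down -hc. Qed.

(** Each insertion computes one line of cells; the recording word is read along the far side of the
    grid. *)
Lemma rs_down (c : rel nat) m n s : (forall i j, i < n -> c i j = (s i == j)) ->
  forall i, i <= n ->
  rs m (down s i) = (down (vlab c i) m, down (fun i => glab c i m) i).
Proof.
move=> hc; elim=> [|i IH] lt /=.
  by congr pair; elim: m => //= m ->.
by rewrite IH ?(ltnW lt) // (strip_down (c i)) // => j; rewrite hc.
Qed.

Lemma cnt_downS (c : rel nat) x i j r : (forall j, c i j = (x == j)) ->
  cnt r.+1 (down (vlab c i.+1) j) = cnt r.+1 (down (vlab c i) j) + (glab c i j == r.+1).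
Proof.
by move=> hc; have := count_strip x (down (vlab c i) j) r; rewrite (strip_down (c i)).
Qed.

Definition graph m (p : 'S_m) : rel nat :=
  fun i j => [exists a : 'I_m, (val a == i) && (val (p a) == j)].

Lemma graphP m (p : 'S_m) i j :
  reflect (exists2 a : 'I_m, val a = i & val (p a) = j) (graph m p i j).
Proof.
apply: (iffP existsP) => [[a /andP[/eqP ? /eqP ?]]|[a <- <-]]; first by exists a.
by exists a; rewrite !eqxx.
Qed.

Lemma graph_fun m (p : 'S_m) i j j' : graph m p i j -> graph m p i j' -> j = j'.
Proof. by move=> /graphP[a <- <-] /graphP[b /val_inj-> <-]. Qed.

Lemma graphE m (p : 'S_m) i j : i < m -> graph m p i j = (nth 0 (one_line p) i == j).
Proof.
move=> lt; rewrite (nth_map (Ordinal lt)) ?size_enum_ord //.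
apply/graphP/eqP => [[a ea <-]|<-].
  by congr (val (p _)); apply: val_inj; rewrite /= nth_enum_ord.
by exists (nth (Ordinal lt) (enum 'I_m) i); rewrite /= ?nth_enum_ord.
Qed.

Lemma size_one_line m (p : 'S_m) : size (one_line p) = m.
Proof. by rewrite size_map size_enum_ord. Qed.

Lemma rs_one_line m (p : 'S_m) : rs m (rev (one_line p)) =
  (down (vlab (graph m p) m) m, down (fun i => glab (graph m p) i m) m).
Proof.
have := mkseq_nth 0 (one_line p); rewrite size_one_line => {1}<-.
by rewrite rev_mkseq (rs_down (graph m p) m m) // => i j; apply: graphE.
Qed.

Lemma word_of_one_line m (p : 'S_m) : word_of m (rev (one_line p)).
Proof.
rewrite /word_of rev_uniq all_rev map_inj_uniq ?enum_uniq //=; last first.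
  by move=> i j /val_inj/perm_inj.
by apply/allP => _ /mapP[i _ ->] /=.
Qed.

(** * Schensted's theorem on the first row *)

(* The length of the first row of the shape at the grid point (i, j). *)
Definition nfirst m (p : 'S_m) i j := cnt 1 (down (vlab (graph m p) i) j).

Lemma nfirstSr m (p : 'S_m) i j :
  nfirst m p i j.+1 = (vlab (graph m p) i j == 1) + nfirst m p i j.
Proof. by []. Qed.

(** Labels along line [i] start at 0, and only a marked cell raises a 0; the line has no other
    mark. *)
Lemma glab_graph0 m (p : 'S_m) i j : graph m p i j -> glab (graph m p) i j = 0.
Proof.
move=> gij; suff H j' : j' <= j -> glab (graph m p) i j' = 0 by exact: H.
elim: j' => // j' IH lt; rewrite glabS IH ?(ltnW lt) // /grows /=.
case gij': (graph m p i j'); last by rewrite andbF.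
by move: lt; rewrite (graph_fun _ _ _ _ _ gij gij') ltnn.
Qed.

Lemma graphV m (p : 'S_m) i j : graph m (p^-1)%g j i = graph m p i j.
Proof.
apply/graphP/graphP => [[a <- <-]|[a <- <-]].
  by exists ((p^-1)%g a); rewrite ?permKV.
by exists (p a); rewrite ?permK.
Qed.

Lemma vlab_graph0 m (p : 'S_m) i j : graph m p i j -> vlab (graph m p) i j = 0.
Proof.
move=> gij; have [_ <-] := grid_transpose _ _ (graphV m p) i j.
by apply: glab_graph0; rewrite graphV.
Qed.

Lemma rs_one_lineV m (p : 'S_m) : rs m (rev (one_line (p^-1)%g)) =
  ((rs m (rev (one_line p))).2, (rs m (rev (one_line p))).1).
Proof.
have E := grid_transpose _ _ (graphV m p).
have Ed f g n : f =1 g -> down f n = down g n.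
  by move=> fg; elim: n => //= n ->; rewrite fg.
by rewrite !rs_one_line; congr pair; apply: Ed => i /=; have [] := E i m; have [] := E m i.
Qed.

Lemma nfirstSl m (p : 'S_m) i j : i < m ->
  nfirst m p i.+1 j = nfirst m p i j + (glab (graph m p) i j == 1).
Proof.
by move=> lt; apply: (cnt_downS _ (nth 0 (one_line p) i)) => k; apply: graphE.
Qed.

Lemma nfirst_graph m (p : 'S_m) i j : i < m -> graph m p i j ->
  nfirst m p i.+1 j.+1 = (nfirst m p i j).+1.
Proof.
move=> lt g; rewrite nfirstSr nfirstSl // vlabS (glab_graph0 _ _ _ _ g).
by rewrite (vlab_graph0 _ _ _ _ g) g /= addn0.
Qed.

(** If both labels are 1, the cell raises them to 2 and only one box is gained in the first row. In
    the other unmarked cases at most one label is 1. *)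
Lemma nfirst_max m (p : 'S_m) i j : i < m -> ~~ graph m p i j ->
  nfirst m p i.+1 j.+1 = maxn (nfirst m p i.+1 j) (nfirst m p i j.+1).
Proof.
move=> lt /negPf g; rewrite !nfirstSr !nfirstSl // vlabS g /grows orbF.
move: (glab _ i j) (vlab _ i j) (nfirst _ _ _ _) => a b k.
by case: (a =P b) => [<-|nab]; [case: a => [|[|a]] | ] => /=; lia.
Qed.

Definition in_corner m (p : 'S_m) i j (A : {set 'I_m}) :=
  increasing_on p A && [forall a in A, (a < i) && (p a < j)].

Lemma in_cornerP m (p : 'S_m) i j (A : {set 'I_m}) :
  reflect ({in A &, forall a b : 'I_m, a < b -> p a < p b} /\
           {in A, forall a : 'I_m, a < i /\ p a < j}) (in_corner m p i j A).
Proof.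
apply: (iffP andP) => -[inc bnd]; split.
- by move=> a b aA bA lt; move/forall_inP/(_ a aA)/forall_inP/(_ b bA)/implyP: inc; apply.
- by move=> a aA; apply/andP; move/forall_inP: bnd; apply.
- by apply/forall_inP => a aA; apply/forall_inP => b bA; apply/implyP; apply: inc.
- by apply/forall_inP => a aA; apply/andP; apply: bnd.
Qed.

(** Longest increasing subsequences inside a corner obey the recurrences [nfirst_graph] and
    [nfirst_max]. *)
Lemma nfirst_ub m (p : 'S_m) i j A : i <= m -> in_corner m p i j A ->
  #|A| <= nfirst m p i j.
Proof.
have A0 (B : {set 'I_m}) : {in B, forall a, False} -> #|B| = 0.
  move=> h; apply/eqP; rewrite cards_eq0; apply/eqP/setP => a.
  by rewrite inE; apply/negP => /h.
elim: i j A => [|i IHi] j A lt.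
  by move=> /in_cornerP[_ bnd]; rewrite A0 // => a /bnd[].
elim: j A => [|j IHj] A /in_cornerP[inc bnd].
  by rewrite A0 // => a /bnd[].
have [/graphP[a0 ea0 epa0]|g] := boolP (graph m p i j).
  rewrite nfirst_graph //; last by apply/graphP; exists a0.
  rewrite (cardsD1 a0) -add1n leq_add ?leq_b1 // IHi ?(ltnW lt) //.
  apply/in_cornerP; split=> [a b /setD1P[_ aA] /setD1P[_ bA]|a /setD1P[na aA]].
    exact: inc.
  have [lai lpj] := bnd a aA; split.
    by rewrite -ea0 ltn_neqAle -ltnS ea0 lai andbT -ea0 (inj_eq val_inj).
  by rewrite -epa0 ltn_neqAle -ltnS epa0 lpj andbT -epa0 (inj_eq val_inj) (inj_eq perm_inj).
rewrite nfirst_max // leq_max.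
(* An increasing set using position [i] cannot use value [j]: that value would sit at an earlier
   position and exceed the value at [i]. So the set fits into one of the two smaller corners. *)
have [/existsP[a /andP[aA /eqP ea]]|nA] := boolP [exists a in A, val a == i].
  rewrite IHj //; apply/in_cornerP; split=> // b bA.
  have [lbi lpbj] := bnd b bA; split=> //.
  rewrite ltn_neqAle -ltnS lpbj andbT; apply/eqP => epb.
  have nba : b != a.
    by apply: contra g => /eqP e; apply/graphP; exists a => //; rewrite -e.
  have [_ lpaj] := bnd a aA.
  have : b < a by rewrite ltn_neqAle (inj_eq val_inj) nba -ltnS -[val a]/(nat_of_ord a) ea.
  by move/(inc _ _ bA aA); rewrite epb ltnNge -ltnS lpaj.
rewrite [X in _ || X]IHi ?orbT ?(ltnW lt) //; apply/in_cornerP; split=> // b bA.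
have [lbi lpbj] := bnd b bA; split=> //.
rewrite ltn_neqAle -ltnS lbi andbT; apply: contra nA => e.
by apply/existsP; exists b; rewrite bA.
Qed.

Lemma nfirst_lb m (p : 'S_m) i j : i <= m ->
  exists A, in_corner m p i j A /\ #|A| = nfirst m p i j.
Proof.
have E0 i' j' : in_corner m p i' j' set0.
  by apply/in_cornerP; split=> [a b|a]; rewrite inE.
elim: i j => [|i IHi] j lt.
  exists set0; split=> //; rewrite cards0 /nfirst.
  by elim: j => //= j IH; rewrite cnt_cons -IH.
elim: j => [|j IHj]; first by exists set0; rewrite cards0.
have [g|g] := boolP (graph m p i j).
  have [A [/in_cornerP[inc bnd] cA]] := IHi j (ltnW lt).
  have /graphP[a0 ea0 epa0] := g.
  exists (a0 |: A); split; last first.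
    rewrite cardsU1 nfirst_graph // cA; case: (boolP (a0 \in A)) => // /bnd[].
    by rewrite -[nat_of_ord a0]/(val a0) ea0 ltnn.
  apply/in_cornerP; split=> [a b|a].
    case/setU1P=> [->|aA] /setU1P[->|bA]; rewrite ?ltnn //; last exact: inc.
      by have [lb _] := bnd b bA; rewrite -[nat_of_ord a0]/(val a0) ea0; lia.
    by have [_ lp] := bnd a aA; rewrite -[nat_of_ord (p a0)]/(val (p a0)) epa0; lia.
  case/setU1P=> [->|/bnd[]]; last by lia.
  by rewrite -[nat_of_ord a0]/(val a0) -[nat_of_ord (p a0)]/(val (p a0)) ea0 epa0.
rewrite nfirst_max //.
have mono A i' j' i'' j'' : i' <= i'' -> j' <= j'' ->
    in_corner m p i' j' A -> in_corner m p i'' j'' A.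
  move=> li lj /in_cornerP[inc bnd]; apply/in_cornerP; split=> // a /bnd[la lpa].
  by split; [apply: leq_trans li | apply: leq_trans lj].
case: leqP => _.
  have [A [cA <-]] := IHi j.+1 (ltnW lt).
  by exists A; split=> //; apply: mono cA.
by have [A [cA <-]] := IHj; exists A; split=> //; apply: mono cA.
Qed.

Lemma longest_incr_rs m (p : 'S_m) :
  longest_incr p = cnt 1 (rs m (rev (one_line p))).1.
Proof.
rewrite rs_one_line /= -/(nfirst m p m m); apply/eqP; rewrite eqn_leq; apply/andP; split.
  apply/bigmax_leqP => A incA; apply: nfirst_ub => //.
  by rewrite /in_corner incA /=; apply/forall_inP => a _; rewrite !ltn_ord.
have [A [/andP[incA _] <-]] := nfirst_lb m p m m (leqnn m).
exact: (leq_bigmax_cond (P := increasing_on p)).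
Qed.

Lemma one_line_inj m : injective (@one_line m).
Proof.
move=> p q e; apply/permP => i; apply: val_inj.
have : graph m q i (p i) by rewrite graphE // -e -graphE //; apply/graphP; exists i.
by case/graphP => a /val_inj ->.
Qed.

Lemma one_line_surj m w : word_of m w -> size w = m ->
  exists p : 'S_m, rev (one_line p) = w.
Proof.
case/andP=> uw /allP aw sw.
have lt (i : 'I_m) : nth 0 (rev w) i < m.
  by apply: aw; rewrite -mem_rev mem_nth // size_rev sw.
pose f i := Ordinal (lt i).
have finj : injective f.
  move=> i j /(congr1 val)/= /eqP; rewrite nth_uniq ?size_rev ?sw ?rev_uniq //.
  by move/eqP/val_inj.
exists (perm finj); apply: (canLR revK); apply: (@eq_from_nth _ 0).
  by rewrite size_one_line size_rev.
move=> i; rewrite size_one_line => li.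
rewrite (nth_map (Ordinal li)) ?size_enum_ord // permE /=.
by rewrite nth_enum_ord.
Qed.

(** * Counting Yamanouchi words with four letters *)

(* Yamanouchi words with a, b, c, d letters 1, 2, 3, 4, when a >= b >= c >= d. *)
Fixpoint ywords (n a b c d : nat) : seq (seq nat) :=
  if n is n'.+1 then
    [seq 1 :: w | w <- if b < a then ywords n' a.-1 b c d else [::]] ++
    [seq 2 :: w | w <- if c < b then ywords n' a b.-1 c d else [::]] ++
    [seq 3 :: w | w <- if d < c then ywords n' a b c.-1 d else [::]] ++
    [seq 4 :: w | w <- if 0 < d then ywords n' a b c d.-1 else [::]]
  else if a + b + c + d == 0 then [:: [::]] else [::].

Lemma mem_map_cons (h r : nat) w s :
  (h :: w \in [seq r :: v | v <- s]) = (h == r) && (w \in s).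
Proof.
apply/mapP/andP => [[v vs [-> ->]]|[/eqP-> ws]]; first by rewrite eqxx.
by exists w.
Qed.

(** Rules out any letter [r] outside 1..4 once the four counts fill the length. *)
Lemma cnt_le_size w r : (r == 0) || (4 < r) ->
  cnt 1 w + cnt 2 w + cnt 3 w + cnt 4 w + cnt r w <= size w.
Proof.
move=> hr; elim: w => // h w IH; rewrite !cnt_cons /=.
by case: h => [|[|[|[|[|h]]]]] /=; case: r hr IH => [|[|[|[|[|r]]]]] //= _; lia.
Qed.

Lemma mem_ywords n a b c d w : d <= c <= b -> b <= a -> (w \in ywords n a b c d) =
  [&& yam w, size w == n, a + b + c + d == n,
      cnt 1 w == a, cnt 2 w == b, cnt 3 w == c & cnt 4 w == d].
Proof.
elim: n a b c d w => [|n IH] a b c d w ldb lba.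
  rewrite /=; case: w => [|h w] /=; last by rewrite andbF; case: ifP.
  by rewrite /cnt /=; case: ifP => [|h]; rewrite ?mem_seq1 ?eqxx ?in_nil; lia.
rewrite [ywords _ _ _ _ _]/= !mem_cat.
case: w => [|h w].
  rewrite andbF; apply/negP.
  by case/or4P => /mapP[].
have ifE (B : bool) a' b' c' d' : (B -> d' <= c' <= b' /\ b' <= a') ->
    (w \in if B then ywords n a' b' c' d' else [::]) = B &&
    [&& yam w, size w == n, a' + b' + c' + d' == n,
      cnt 1 w == a', cnt 2 w == b', cnt 3 w == c' & cnt 4 w == d'].
  by case: B => // /(_ isT)[]; apply: IH.
rewrite !mem_map_cons !ifE; try lia.
rewrite /= !cnt_cons eqSS.
have Y := yam_count w; have := cnt_le_size w 0 isT.
case yw: (yam w); rewrite ?andbF //=.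
have Y1 := Y 0 yw; have Y2 := Y 1 yw; have Y3 := Y 2 yw.
by case: h => [|[|[|[|[|h]]]]] /= lw; lia.
Qed.

Lemma ywords_uniq n a b c d : uniq (ywords n a b c d).
Proof.
elim: n a b c d => [|n IH] a b c d /=; first by case: ifP.
have U (B : bool) h a' b' c' d' :
    uniq [seq h :: w | w <- if B then ywords n a' b' c' d' else [::]].
  by rewrite map_inj_uniq => [|x y []] //; case: B.
have H h h' (s s' : seq (seq nat)) : h' != h ->
    ~~ has (mem [seq h :: w | w <- s]) [seq h' :: w | w <- s'].
  move=> nh; apply/hasPn => _ /mapP[v _ ->] /=.
  by rewrite [_ \in _]mem_map_cons (negPf nh).
by rewrite !cat_uniq !has_cat !negb_or !U !H.
Qed.

(** Numerator of Frobenius' form of the hook length formula, to be taken at the shifted row lengths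
    a+3, b+2, c+1, d. *)
Definition vandermonde4 (x y z t : int) : int :=
  ((x - y) * (x - z) * (x - t) * (y - z) * (y - t) * (z - t))%R.

(* When a row cannot lose a box, the right-hand side for the shrunken row has a
   repeated argument, and a factor d = 0 covers the last row, so the recurrence
   needs no case distinction on that side. *)
Lemma size_ywords n a b c d : d <= c <= b -> b <= a -> a + b + c + d = n ->
  ((size (ywords n a b c d))%:Z * (((a + 3)`! * (b + 2)`! * (c + 1)`! * d`!)%N)%:Z
   = n`!%:Z * vandermonde4 (a + 3)%N (b + 2)%N (c + 1)%N d)%R.
Proof.
elim: n a b c d => [|n IH] a b c d /andP[ldc lcb] lba en.
  have [-> [-> [-> ->]]] : a = 0 /\ b = 0 /\ c = 0 /\ d = 0 by lia.
  by [].
rewrite [ywords _ _ _ _ _]/= !size_cat !size_map factS !(PoszD (size _)) !mulrDl.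
set F := (Posz (_ * d`!)).
have -> : ((size (if (b < a)%N then ywords n a.-1 b c d else [::]))%:Z * F =
    (a + 3)%N%:Z * (n`!%:Z * vandermonde4 (a + 2)%N (b + 2)%N (c + 1)%N d))%R.
  case: ltnP => h; last first.
    have -> : a = b by lia.
    by rewrite mul0r /vandermonde4 subrr !mul0r !mulr0.
  case: a lba en h @F => // a lba en h F; rewrite -[a.+1.-1]/a.
  rewrite -(_ : (a + 3 = a.+1 + 2)%N) -?IH; try lia.
  rewrite /F -[(a.+1 + 3)%N]/((a + 3).+1) factS !PoszM; ring.
have -> : ((size (if (c < b)%N then ywords n a b.-1 c d else [::]))%:Z * F =
    (b + 2)%N%:Z * (n`!%:Z * vandermonde4 (a + 3)%N (b + 1)%N (c + 1)%N d))%R.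
  case: ltnP => h; last first.
    have -> : b = c by lia.
    by rewrite mul0r /vandermonde4 subrr !(mul0r, mulr0).
  case: b lba lcb en h @F => // b lba lcb en h F; rewrite -[b.+1.-1]/b.
  rewrite -(_ : (b + 2 = b.+1 + 1)%N) -?IH; try lia.
  rewrite /F -[(b.+1 + 2)%N]/((b + 2).+1) factS !PoszM; ring.
have -> : ((size (if (d < c)%N then ywords n a b c.-1 d else [::]))%:Z * F =
    (c + 1)%N%:Z * (n`!%:Z * vandermonde4 (a + 3)%N (b + 2)%N c d))%R.
  case: ltnP => h; last first.
    have -> : d = c by lia.
    by rewrite mul0r /vandermonde4 subrr !(mul0r, mulr0).
  case: c ldc lcb en h @F => // c ldc lcb en h F; rewrite -[c.+1.-1]/c.
  rewrite -(_ : (c + 1 = c.+1)%N) -?IH; try lia.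
  rewrite /F -[(c.+1 + 1)%N]/((c + 1).+1) factS !PoszM; ring.
have -> : ((size (if (0 < d)%N then ywords n a b c d.-1 else [::]))%:Z * F =
    d%:Z * (n`!%:Z * vandermonde4 (a + 3)%N (b + 2)%N (c + 1)%N (d%:Z - 1)))%R.
  case: d ldc en @F => [|d] ldc en F; first by rewrite mul0r mul0r.
  rewrite -[d.+1.-1]/d [(0 < _)%N]/= (_ : (d.+1%:Z - 1)%R = Posz d); last by lia.
  rewrite -IH; try lia.
  rewrite /F factS !PoszM; ring.
(* Polynomial identity for four variables: the sum of x_i V(x - e_i) is (sum of x_i - 6) V(x), and
   here the x_i add up to n + 7. *)
rewrite PoszM -en /vandermonde4 !PoszD; ring.
Qed.

(** * Log concavity of the tableau numbers *)

Definition fcount (n k : nat) : nat := size (ywords (2 * n) k k (n - k) (n - k)).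

(** Value of [vandermonde4] at (k+3, k+2, j+1, j) when d = k - j. *)
Definition hook_num (d : nat) : nat := (d + 1) * (d + 2) ^ 2 * (d + 3).

Lemma fcount_formula k j e : k = j + e ->
  fcount (k + j) k * ((k + 3)`! * (k + 2)`! * (j + 1)`! * j`!) =
  (2 * (k + j))`! * hook_num e.
Proof.
move=> ek; rewrite /fcount addKn.
have := size_ywords (2 * (k + j)) k k j j; rewrite leqnn /= => H.
have Posz_inj x y : Posz x = Posz y -> x = y by case.
apply: Posz_inj; rewrite (PoszM (size _)) H; [|by lia..].
rewrite [RHS]PoszM; congr (_ * _)%R.
by rewrite /vandermonde4 /hook_num ek -mulnn !PoszM !PoszD; ring.
Qed.

Lemma fact_log_convex m : m.+1`! ^ 2 <= m`! * m.+2`!.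
Proof.
rewrite !factS -mulnn [leqRHS]mulnCA -[leqLHS]mulnA.
by rewrite leq_mul2r leqnSn orbT.
Qed.

(** The shifts are by 2 because 2k - n moves by 2 with k. Factors are paired as (e+i)(e+i+4) <=
    (e+i+2)^2. *)
Lemma hook_num_log_concave e : hook_num e * hook_num (e + 4) <= hook_num (e + 2) ^ 2.
Proof.
rewrite (_ : hook_num e * _ = ((e + 1) * (e + 5)) * ((e + 2) * (e + 6)) ^ 2 *
   ((e + 3) * (e + 7))); last by rewrite /hook_num -!mulnn; ring.
rewrite (_ : hook_num (e + 2) ^ 2 = ((e + 3) * (e + 3)) * ((e + 4) * (e + 4)) ^ 2 *
   ((e + 5) * (e + 5))); last by rewrite /hook_num -!mulnn; ring.
by apply: leq_mul; first apply: leq_mul; rewrite ?leq_exp2r //; nia.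
Qed.

Lemma fcount_log_concave n k : 0 < k < n -> n <= 2 * k.-1 ->
  fcount n k.-1 * fcount n k.+1 <= fcount n k ^ 2.
Proof.
case: k => // k lkn; rewrite -[k.+1.-1]/k => le.
(* The three terms have parts (k, j+2), (k+1, j+1), (k+2, j), with differences e, e+2, e+4. *)
pose j := n - k.+2; pose e := k - j.+2.
have ek : k = j.+2 + e by rewrite /e /j; lia.
have en : n = k + j.+2 by rewrite /j; lia.
have H0 := fcount_formula k j.+2 e ek.
have H1 := fcount_formula k.+1 j.+1 (e + 2).
have H2 := fcount_formula k.+2 j (e + 4).
rewrite (_ : k.+1 + j.+1 = n) in H1; last by lia.
rewrite (_ : k.+2 + j = n) in H2; last by lia.
rewrite -en in H0.
have {}H1 := H1 ltac:(lia); have {}H2 := H2 ltac:(lia).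
move: H0 H1 H2; rewrite !addSn !addn1 !addn2 !addn3.
set A0 := (_ * _ * _ * j.+2`!); set A1 := (_ * _ * _ * j.+1`!).
set A2 := (_ * _ * _ * j`!) => H0 H1 H2.
have A10 : 0 < A1 ^ 2 by rewrite expn_gt0 /A1 !muln_gt0 !fact_gt0.
have A020 : 0 < A0 * A2 by rewrite /A0 /A2 !muln_gt0 !fact_gt0.
have lA : A1 ^ 2 <= A0 * A2.
  rewrite /A0 /A1 /A2 3!expnMn.
  have -> : k.+3`! * k.+2`! * j.+3`! * j.+2`! * (k.+2.+3`! * k.+4`! * j.+1`! * j`!) =
    (k.+3`! * k.+2.+3`!) * (k.+2`! * k.+4`!) * (j.+1`! * j.+3`!) * (j`! * j.+2`!) by ring.
  do 2!(apply: leq_mul; last exact: fact_log_convex).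
  by apply: leq_mul; apply: fact_log_convex.
(* Clearing denominators leaves the product of the log concavity of [hook_num] and the log convexity
   of the factorial products. *)
rewrite -(leq_pmul2r (m := A0 * A2)) // -(leq_pmul2r (m := A1 ^ 2)) //.
have -> : fcount n k * fcount n k.+2 * (A0 * A2) * A1 ^ 2 =
  ((2 * n)`! ^ 2 * (hook_num e * hook_num (e + 4))) * A1 ^ 2.
  rewrite (_ : _ * (A0 * A2) = (fcount n k * A0) * (fcount n k.+2 * A2)); last by ring.
  by rewrite H0 H2 -!mulnn; ring.
have -> : fcount n k.+1 ^ 2 * (A0 * A2) * A1 ^ 2 =
  ((2 * n)`! ^ 2 * hook_num e.+2 ^ 2) * (A0 * A2).
  by rewrite -mulnA (mulnC (A0 * A2)) mulnA -expnMn H1 expnMn.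
have lh := hook_num_log_concave e; rewrite addn2 in lh.
by rewrite leq_mul // leq_mul2l lh orbT.
Qed.

(** * Counting permutations by pairs of words *)

Definition pword m (p : 'S_m) : seq nat := (rs m (rev (one_line p))).1.

Lemma pwordV m (p : 'S_m) : pword m (p^-1)%g = (rs m (rev (one_line p))).2.
Proof. by rewrite /pword rs_one_lineV. Qed.

Lemma rs_pword m (p : 'S_m) :
  rs m (rev (one_line p)) = (pword m p, pword m (p^-1)%g).
Proof. by rewrite pwordV -surjective_pairing. Qed.

Lemma pword_inj m (p q : 'S_m) :
  pword m p = pword m q -> pword m (p^-1)%g = pword m (q^-1)%g -> p = q.
Proof.
move=> e1 e2; apply: one_line_inj; apply: (can_inj revK).
by apply: (rs_inj m); rewrite ?word_of_one_line // !rs_pword e1 e2.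
Qed.

(** Inversion swaps the two words and the pair determines the permutation, so equal words mean that
    p is its own inverse. *)
Lemma involution_pword m (p : 'S_m) : involution p = (pword m p == pword m (p^-1)%g).
Proof.
rewrite /involution -eq_invg_mul; apply/eqP/eqP => [-> //|e].
by apply: pword_inj; rewrite ?invgK.
Qed.

Definition d2words n k : seq (seq nat) := ywords (2 * n) k k (n - k) (n - k).

Lemma mem_d2words n k w : n <= 2 * k -> k <= n -> (w \in d2words n k) =
  [&& yam w, size w == 2 * n, cnt 1 w == k, cnt 2 w == k, cnt 3 w == n - k
    & cnt 4 w == n - k].
Proof.
move=> le1 le2; have le : n - k <= k by lia.
rewrite mem_ywords ?leqnn ?le // (_ : _ + _ == _) //.
by apply/eqP; lia.
Qed.

Lemma pword_mem_d2words n k (p : 'S_(2 * n)) : n <= 2 * k -> k <= n ->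
  (pword _ p \in d2words n k) =
  [&& cnt 1 (pword _ p) == k, cnt 2 (pword _ p) == k, cnt 3 (pword _ p) == n - k
    & cnt 4 (pword _ p) == n - k].
Proof. by move=> *; rewrite mem_d2words // /pword yam_rs1 size_rs1 eqxx. Qed.

Lemma nth_double_two_row n k r : 0 < k ->
  nth 0 (double_two_row n k) r = nth 0 [:: k; k; n - k; n - k] r.
Proof.
move=> k0; rewrite /double_two_row /= k0.
by case: (n - k) => [|j] //=; case: r => [|[|[|[|r]]]] /=; rewrite ?nth_nil.
Qed.

Lemma sh_pword m (p : 'S_m) : sh p = shape (tableau_of (pword m p)).
Proof. by rewrite /sh -{1}(revK (one_line p)) (insertion_tableau_rs m) ?word_of_one_line. Qed.

(** The longest increasing length is the first part, which singles out one partition in [d2row]. *)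
Lemma d2row_pword n k (p : 'S_(2 * n)) : 0 < k <= n ->
  (longest_incr p == k) && (sh p \in d2row n) =
  (n <= 2 * k) && (pword _ p \in d2words n k).
Proof.
case/andP=> k0 kn; rewrite longest_incr_rs -/(pword _ p) sh_pword.
have yW : yam (pword (2 * n) p) by apply: yam_rs1.
have sW : size (pword (2 * n) p) = 2 * n by apply: size_rs1.
have [hn h0] := shape_tableau_of _ yW.
apply/andP/andP => [[/eqP e1 /existsP[k' /andP[lk' /eqP es]]]|[le mem]].
  have k'0 : 0 < k' by lia.
  have hn' r : cnt r.+1 (pword (2 * n) p) = nth 0 [:: val k'; val k'; n - k'; n - k'] r.
    by rewrite -hn es nth_double_two_row.
  have ek : val k' = k by rewrite -e1 hn'.
  rewrite -[nat_of_ord k']/(val k') ek in lk'; split=> //.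
  by rewrite pword_mem_d2words // !hn' /= -!/(val k') -[nat_of_ord k']/(val k') ek !eqxx.
have := mem; rewrite pword_mem_d2words // => /and4P[/eqP e1 /eqP e2 /eqP e3 /eqP e4].
rewrite e1 eqxx; split=> //.
apply/existsP; exists (inord k); rewrite inordK ?ltnS // le /=; apply/eqP.
apply: eq_from_nth_pos => // [|r]; first by rewrite mem_filter.
rewrite hn nth_double_two_row //; case: r => [|[|[|[|r]]]] //=.
(* The first four rows already hold all 2n boxes. *)
rewrite nth_nil; have := cnt_le_size (pword (2 * n) p) r.+4.+1 isT.
by rewrite e1 e2 e3 e4 sW; lia.
Qed.

Lemma pword_surj n k W Q : n <= 2 * k -> k <= n ->
  W \in d2words n k -> Q \in d2words n k ->
  exists p : 'S_(2 * n), pword _ p = W /\ pword _ (p^-1)%g = Q.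
Proof.
move=> le1 le2; rewrite !mem_d2words //.
case/and5P=> yW /eqP sW /eqP w1 /eqP w2 /andP[/eqP w3 /eqP w4].
case/and5P=> yQ /eqP sQ /eqP q1 /eqP q2 /andP[/eqP q3 /eqP q4].
have [|r|w [ww ew]] := rs_surj (2 * n) W Q yW yQ _ sW.
- apply/negP => /count_memPn; have := cnt_le_size Q 0 isT.
  by rewrite q1 q2 q3 q4 sQ /cnt; lia.
- case: r => [|[|[|[|r]]]]; rewrite ?w1 ?w2 ?w3 ?w4 ?q1 ?q2 ?q3 ?q4 //.
  have := cnt_le_size W r.+4.+1 isT; have := cnt_le_size Q r.+4.+1 isT.
  by rewrite w1 w2 w3 w4 q1 q2 q3 q4 sW sQ; lia.
have [|p ep] := one_line_surj (2 * n) w ww.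
  by rewrite -(size_rs2 (2 * n)) ew.
by exists p; have := rs_pword _ p; rewrite ep ew => -[].
Qed.

Lemma card_set_seq (T : finType) (U : eqType) (f : T -> U) (S : {set T}) (s : seq U) :
  {in S &, injective f} -> uniq s ->
  (forall u, reflect (exists2 x, x \in S & f x = u) (u \in s)) -> #|S| = size s.
Proof.
move=> finj us hs; rewrite cardE -(size_map f); apply/perm_size/uniq_perm => //.
  by rewrite map_inj_in_uniq ?enum_uniq // => x y; rewrite !mem_enum; apply: finj.
move=> u; apply/mapP/hs => [[x xS ->]|[x xS <-]].
  by exists x; rewrite // -mem_enum.
by exists x; rewrite ?mem_enum.
Qed.

Lemma pwordV_mem_d2words n k (p : 'S_(2 * n)) : n <= 2 * k -> k <= n ->
  (pword _ (p^-1)%g \in d2words n k) = (pword _ p \in d2words n k).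
Proof.
move=> le1 le2; rewrite !pword_mem_d2words //.
by rewrite pwordV /pword -!count_rs.
Qed.

(** The two words share their letter counts, so the permutations correspond to all pairs from
    [d2words]; involutions give the diagonal pairs. *)
Lemma ell_d2rowE n k : 0 < k <= n ->
  ell_d2row n k = (if n <= 2 * k then fcount n k else 0) ^ 2.
Proof.
move=> hk; have /andP[_ kn] := hk; rewrite /ell_d2row.
under eq_finset => p do rewrite d2row_pword //.
case: leqP => le /=; last by rewrite exp0n //; apply: eq_card0 => p; rewrite inE.
rewrite (card_set_seq _ _ (fun p => (pword _ p, pword _ (p^-1)%g)) _
  [seq (W, Q) | W <- d2words n k, Q <- d2words n k]).
- by rewrite size_allpairs mulnn.
- by move=> p q _ _ []; apply: pword_inj.
- by apply: allpairs_uniq; rewrite ?ywords_uniq // => -[? ?] [? ?].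
move=> [W Q]; apply: (iffP allpairsP) => [[[W' Q'] [/= mW mQ [-> ->]]]|[p]].
  have [p [e1 e2]] := pword_surj n k W' Q' le kn mW mQ.
  by exists p; rewrite ?inE ?e1 ?e2.
rewrite inE => mp [<- <-]; exists (pword _ p, pword _ (p^-1)%g).
by rewrite /= pwordV_mem_d2words.
Qed.

Lemma inv_d2rowE n k : 0 < k <= n ->
  inv_d2row n k = if n <= 2 * k then fcount n k else 0.
Proof.
move=> hk; have /andP[_ kn] := hk; rewrite /inv_d2row.
under eq_finset => p do rewrite d2row_pword // involution_pword.
case: leqP => le /=; last by apply: eq_card0 => p; rewrite inE andbF.
apply: (card_set_seq _ _ (pword _)).
- move=> p q; rewrite !inE => /andP[/eqP ep _] /andP[/eqP eq _] e.
  by apply: pword_inj; rewrite // -ep -eq.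
- exact: ywords_uniq.
move=> W; apply: (iffP idP) => [mW|[p]]; last by rewrite inE => /andP[_ mp] <-.
have [p [e1 e2]] := pword_surj n k W W le kn mW mW.
by exists p; rewrite ?inE ?e1 ?e2 ?eqxx.
Qed.

(** At k = 1 and k = n a neighbour is replaced by 0, so only interior indices matter. *)
Lemma log_concave_natr (R : realDomainType) n (f : nat -> nat) :
  (forall k, 1 < k < n -> f k.-1 * f k.+1 <= f k ^ 2) ->
  log_concave n (fun k => (f k)%:R%R : R).
Proof.
move=> hf l0 k hk; rewrite /l0.
have [h1|] := boolP (1 < k < n).
  have -> : 0 < k.-1 <= n by lia.
  have -> : 0 < k.+1 <= n by lia.
  by rewrite hk -natrM -natrX ler_nat hf.
move=> h1; have [|] : ~~ (0 < k.-1 <= n) \/ ~~ (0 < k.+1 <= n) by lia.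
  by move/negPf->; rewrite mul0r sqr_ge0.
by move/negPf->; rewrite mulr0 sqr_ge0.
Qed.

Theorem theorem4p5 (R : realDomainType) (n : nat) (hn : 0 < n) :
  log_concave n (fun k => (ell_d2row n k)%:R%R : R) /\
  log_concave n (fun k => (inv_d2row n k)%:R%R : R).
Proof.
have lc k : 1 < k < n ->
    (if n <= 2 * k.-1 then fcount n k.-1 else 0) *
    (if n <= 2 * k.+1 then fcount n k.+1 else 0) <=
    (if n <= 2 * k then fcount n k else 0) ^ 2.
  (* If n > 2(k-1), the left factor is 0; otherwise all three conditions hold. *)
  move=> hk; case: (leqP n (2 * k.-1)) => le1 //.
  have -> : n <= 2 * k.+1 by lia.
  have -> : n <= 2 * k by lia.
  by apply: fcount_log_concave => //; lia.
split; apply: log_concave_natr => k hk.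
  by rewrite !ell_d2rowE; [rewrite -expnMn leq_exp2r ?lc | lia..].
by rewrite !inv_d2rowE; [apply: lc | lia..].
Qed.
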